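(* Consider the three-pile Amalgamation Nim with Restriction, with positions $(x,y,z)\in\mathbb{Z}_{\ge 0}^3$. The set $P$ is exactly the set of $\mathcal{P}$-positions of this game; that is, for all $(x,y,z)\in\mathbb{Z}_{\ge 0}^3$, the position $(x,y,z)$ is a $\mathcal{P}$-position if and only if $(x,y,z)\in P$.
   Context: $\mathbb{Z}_{\ge 0}$ denotes the non-negative integers and $\oplus$ denotes nim-sum (bitwise exclusive or of binary expansions). The game (Amalgamation Nim with Restriction, three piles): a position is $(x,y,z)\in\mathbb{Z}_{\ge 0}^3$, the numbers of stones in the first, second and third pile. Two players alternate; the player who makes the last legal move wins. In a move, a player does one of the following. (1) (Removal) Choose a pile and remove any positive number of stones from it: $(x,y,z)\to(u,y,z)$ with $0\le u<x$, or $(x,v,z)$ with $0\le v<y$, or $(x,y,w)$ with $0\le w<z$. (2) (Amalgamation) Choose two piles each containing at least 2 stones and replace them by a single pile containing their total: $(x,y,z)\to(x+y,0,z)$ or $(0,x+y,z)$ if $x,y\ge 2$; $(x,y,z)\to(x,y+z,0)$ or $(x,0,y+z)$ if $y,z\ge 2$; $(x,y,z)\to(x+z,y,0)$ or $(0,y,x+z)$ if $x,z\ge 2$. A $\mathcal{P}$-position is a position from which the previous player (the one who has just moved) has a winning strategy; otherwise it is an $\mathcal{N}$-position. Sets of triples (all $x,y,z\in\mathbb{Z}_{\ge 0}$): $P_{0,1}=\{(x,y,z): x+y=z,\ x,y\le z,\ x\oplus y\oplus z=0,\ \min(x,y)<2\}$. $P_{0,2}=\{(x,y,z): x+y>z+2,\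 x,y\le z,\ x\oplus y\oplus z=0\}$. $N_{0,1}=\{(x,y,z): x+y=z,\ x,y\le z,\ x\oplus y\oplus z=0,\ x,y\ge 2\}$. $N_{0,2}=\{(x,y,z): x+y=z+2,\ x,y\le z,\ x\oplus y\oplus z=0\}$. For $k\in\{1,2\}$: $P_{1,k}=\{(x,y,z+1): x+y \text{ even},\ (x,y,z)\in N_{0,k}\}\cup\{(x,y,z-1): x+y\text{ odd},\ (x,y,z)\in N_{0,k}\}$. For $k\in\{0,1\}$: $P_k$ is the set of all $(x,y,z)$ such that at least one of $(x,y,z)$, $(x,z,y)$, $(y,z,x)$ belongs to $P_{k,1}\cup P_{k,2}$. $P=P_0\cup P_1$. *)

(* Defs.v *)
From Stdlib Require Import Arith.

Definition position : Type := nat * nat * nat.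

Inductive move : position -> position -> Prop :=
| remove1 x y z u : u < x -> move (x, y, z) (u, y, z)
| remove2 x y z v : v < y -> move (x, y, z) (x, v, z)
| remove3 x y z w : w < z -> move (x, y, z) (x, y, w)
| amalg12 x y z : 2 <= x -> 2 <= y -> move (x, y, z) (x + y, 0, z)
| amalg21 x y z : 2 <= x -> 2 <= y -> move (x, y, z) (0, x + y, z)
| amalg23 x y z : 2 <= y -> 2 <= z -> move (x, y, z) (x, y + z, 0)
| amalg32 x y z : 2 <= y -> 2 <= z -> move (x, y, z) (x, 0, y + z)
| amalg13 x y z : 2 <= x -> 2 <= z -> move (x, y, z) (x + z, y, 0)
| amalg31 x y z : 2 <= x -> 2 <= z -> move (x, y, z) (0, y, x + z).

(* A strategy is positional: it names a reply to each position.  This is no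
   restriction, since a move's legality and the outcome of a play do not depend
   on how a position was reached. *)
Definition strategy : Type := position -> position.

(* [previous_wins s p]: with the opponent to move at [p], the player who has
   just moved and answers according to [s] always has a legal answer, and every
   such play ends (the predicate is inductive), hence ends with the opponent
   unable to move. *)
Inductive previous_wins (s : strategy) (p : position) : Prop :=
| previous_wins_intro :
    (forall q, move p q -> move q (s q) /\ previous_wins s (s q)) ->
    previous_wins s p.

Definition P_position (p : position) : Prop :=
  exists s : strategy, previous_wins s p.

Definition nim_zero (p : position) : Prop :=
  let '(x, y, z) := p in
  x <= z /\ y <= z /\ Nat.lxor (Nat.lxor x y) z = 0.

Definition P01 (p : position) : Prop :=
  let '(x, y, z) := p in x + y = z /\ nim_zero p /\ Nat.min x y < 2.

Definition P02 (p : position) : Prop :=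
  let '(x, y, z) := p in x + y > z + 2 /\ nim_zero p.

Definition N01 (p : position) : Prop :=
  let '(x, y, z) := p in x + y = z /\ nim_zero p /\ 2 <= x /\ 2 <= y.

Definition N02 (p : position) : Prop :=
  let '(x, y, z) := p in x + y = z + 2 /\ nim_zero p.

(* [shift N] is [P_{1,k}] for [N = N_{0,k}].  The predecessor case is written
   with [(x, y, w + 1)] in [N] rather than with [w = z - 1], because
   subtraction on [nat] is truncated. *)
Definition shift (N : position -> Prop) (p : position) : Prop :=
  let '(x, y, w) := p in
  (Nat.Even (x + y) /\ exists z, w = z + 1 /\ N (x, y, z)) \/
  (Nat.Odd (x + y) /\ N (x, y, w + 1)).

Definition P11 : position -> Prop := shift N01.

Definition P12 : position -> Prop := shift N02.

Definition some_order (A B : position -> Prop) (p : position) : Prop :=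
  let '(x, y, z) := p in
  (A (x, y, z) \/ B (x, y, z)) \/
  (A (x, z, y) \/ B (x, z, y)) \/
  (A (y, z, x) \/ B (y, z, x)).

Definition P0 : position -> Prop := some_order P01 P02.

Definition P1 : position -> Prop := some_order P11 P12.

Definition P (p : position) : Prop := P0 p \/ P1 p.

(* Main.v *)
(** Write [x = 2a + i], [y = 2b + j], [z = 2c + k] with bits [i], [j], [k].  Then
    [(x, y, z)] lies in [P] iff [a], [b], [c] have nim-sum zero and [i], [j], [k]
    have nim-sum one or zero according to whether or not [a], [b], [c] are
    positive with one of them the sum of the other two ([balanced] below).  In
    this symmetric form the argument is short.  A removal between two balanced
    positions would keep the halves, hence flip exactly one bit.  An amalgamation
    reaches a balanced position only if it leaves two equal piles, so
    [x + y = z], say; then there is no carry, [a + b = c] and [i + j = k],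
    against the bit condition.  From an unbalanced position, if the halves have
    nonzero nim-sum, play the Nim move on the halves and choose the low bit
    freely; otherwise remove one stone from an odd pile, and if all piles are
    even, one is the sum of the other two and amalgamating these wins. *)

From Stdlib Require Import Arith Lia Bool ClassicalEpsilon.
Require Import Defs.

(** * Nim-sums through halves and low bits *)

Lemma lxor_double_bit a b i j :
  Nat.lxor (2 * a + Nat.b2n i) (2 * b + Nat.b2n j) =
  2 * Nat.lxor a b + Nat.b2n (xorb i j).
Proof.
  apply Nat.bits_inj; intros [|n]; rewrite Nat.lxor_spec.
  - now rewrite !Nat.testbit_0_r.
  - now rewrite !Nat.testbit_succ_r, Nat.lxor_spec.
Qed.

Lemma double_bit n : exists a i, n = 2 * a + Nat.b2n i.
Proof. exists (Nat.div2 n), (Nat.odd n); apply Nat.div2_odd. Qed.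

(** The witness is the bitwise conjunction of [a] and [b], the carries of binary addition. *)
Lemma lxor_carry a b : exists d, a + b = Nat.lxor a b + 2 * d.
Proof.
  revert b; induction a as [a IH] using lt_wf_ind; intros b.
  destruct (Nat.eq_dec a 0) as [->|Ha].
  { exists 0; rewrite Nat.lxor_0_l; lia. }
  destruct (double_bit a) as (a' & i & ->), (double_bit b) as (b' & j & ->).
  destruct (IH a' ltac:(lia) b') as [d Hd].
  rewrite lxor_double_bit.
  exists (2 * d + Nat.b2n (i && j)); destruct i, j; cbn [Nat.b2n xorb andb negb]; lia.
Qed.

Lemma lxor_eq_swap a b c : Nat.lxor a b = c -> Nat.lxor a c = b.
Proof.
  intros <-; now rewrite <- Nat.lxor_assoc, Nat.lxor_nilpotent, Nat.lxor_0_l.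
Qed.

Lemma lxor_zero_eq a b c : Nat.lxor (Nat.lxor a b) c = 0 <-> Nat.lxor a b = c.
Proof.
  split; [apply Nat.lxor_eq | intros ->; apply Nat.lxor_nilpotent].
Qed.

(** The winning move of Nim. If the halves already have nim-sum zero, some low bit is set and
    clearing it works; otherwise a strict inequality between halves survives any choice of low
    bits. *)
Lemma nim_reduce a b c :
  Nat.lxor a b <> c ->
  Nat.lxor a b < c \/ Nat.lxor a c < b \/ Nat.lxor b c < a.
Proof.
  revert a b; induction c as [c IH] using lt_wf_ind; intros a b H.
  destruct (Nat.eq_dec c 0) as [->|Hc].
  { rewrite !Nat.lxor_0_r.
    assert (a <> b) by (intros ->; now rewrite Nat.lxor_nilpotent in H).
    lia. }
  destruct (double_bit a) as (a' & i & ->), (double_bit b) as (b' & j & ->),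
    (double_bit c) as (c' & k & ->).
  rewrite !lxor_double_bit in *.
  destruct (Nat.eq_dec (Nat.lxor a' b') c') as [E|E].
  - pose proof (lxor_eq_swap _ _ _ E).
    rewrite Nat.lxor_comm in E; pose proof (lxor_eq_swap _ _ _ E).
    rewrite Nat.lxor_comm in E.
    destruct i, j, k; cbn [Nat.b2n xorb negb] in *; lia.
  - destruct (IH c' ltac:(lia) a' b' E) as [L|[L|L]];
      destruct i, j, k; cbn [Nat.b2n xorb negb]; lia.
Qed.

(** * Balanced positions and their symmetry *)

Definition sum_triple (a b c : nat) : Prop :=
  0 < a /\ 0 < b /\ 0 < c /\ (a + b = c \/ a + c = b \/ b + c = a).

Definition balanced (p : position) : Prop :=
  let '(x, y, z) := p in
  Nat.lxor (Nat.div2 x) (Nat.div2 y) = Nat.div2 z /\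
  (xorb (xorb (Nat.odd x) (Nat.odd y)) (Nat.odd z) = true <->
   sum_triple (Nat.div2 x) (Nat.div2 y) (Nat.div2 z)).

Lemma div2_double_bit a i : Nat.div2 (2 * a + Nat.b2n i) = a.
Proof. rewrite Nat.div2_div, Nat.add_comm; apply Nat.add_b2n_double_div2. Qed.

Lemma odd_double_bit a i : Nat.odd (2 * a + Nat.b2n i) = i.
Proof. rewrite <- Nat.bit0_odd; apply Nat.testbit_0_r. Qed.

Lemma balanced_double_bit a b c i j k :
  balanced (2 * a + Nat.b2n i, 2 * b + Nat.b2n j, 2 * c + Nat.b2n k) <->
  Nat.lxor a b = c /\ (xorb (xorb i j) k = true <-> sum_triple a b c).
Proof.
  unfold balanced; rewrite !div2_double_bit, !odd_double_bit; reflexivity.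
Qed.

Lemma balanced_swap12 x y z : balanced (x, y, z) -> balanced (y, x, z).
Proof.
  unfold balanced, sum_triple; intros [E H].
  rewrite Nat.lxor_comm, (xorb_comm (Nat.odd y)); split; [exact E|].
  rewrite H; lia.
Qed.

Lemma balanced_swap23 x y z : balanced (x, y, z) -> balanced (x, z, y).
Proof.
  unfold balanced, sum_triple; intros [E H].
  split; [now apply lxor_eq_swap|].
  rewrite xorb_assoc, (xorb_comm (Nat.odd z)), <- xorb_assoc, H; lia.
Qed.

Ltac split_bits x :=
  let a := fresh "a" in let i := fresh "i" in
  destruct (double_bit x) as (a & i & ->).

(** * Agreement of [balanced] with [P] *)

Lemma balanced_sorted_P x y z :
  x <= z -> y <= z -> balanced (x, y, z) ->
  P01 (x, y, z) \/ P02 (x, y, z) \/ P11 (x, y, z) \/ P12 (x, y, z).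
Proof.
  intros Hx Hy H.
  split_bits x; split_bits y; split_bits z.
  rewrite balanced_double_bit in H; destruct H as [E H].
  pose proof (lxor_carry a a0) as [d Hd]; rewrite E in Hd.
  unfold sum_triple in H.
  destruct (xorb (xorb i i0) i1) eqn:B.
  - assert (S : sum_triple a a0 a1) by now apply H.
    unfold sum_triple in S.
    right; right.
    unfold P11, P12, shift, N01, N02, nim_zero.
    setoid_rewrite lxor_zero_eq.
    rewrite lxor_double_bit, E.
    (* Here [a + a0 = a1]. Three set bits give [P12]; a single set bit gives [P11]. *)
    destruct i, i0, i1; try discriminate B; cbn [Nat.b2n xorb negb] in *.
    + right; left; split; [exists (a + a0 + 1); lia|].
      exists (2 * a1); lia.
    + left; right; split; [exists (a + a0); lia|]; lia.
    + left; right; split; [exists (a + a0); lia|]; lia.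
    + left; left; split; [exists (a + a0); lia|].
      exists (2 * a1); lia.
  - assert (S : ~ sum_triple a a0 a1) by (intros S; apply H in S; discriminate).
    unfold sum_triple in S.
    unfold P01, P02, nim_zero.
    rewrite lxor_zero_eq, lxor_double_bit, E.
    (* The excess of [x + y] over [z] is 4d, plus 2 if [i] and [i0] are both set. If [d = 0], then
       [a] or [a0] is 0, and two set bits would make the other pile exceed [z]. *)
    destruct i, i0, i1; try discriminate B; cbn [Nat.b2n xorb negb] in *; lia.
Qed.

Lemma P_sorted_balanced x y z :
  P01 (x, y, z) \/ P02 (x, y, z) \/ P11 (x, y, z) \/ P12 (x, y, z) ->
  balanced (x, y, z).
Proof.
  unfold P01, P02, P11, P12, shift, N01, N02, nim_zero.
  setoid_rewrite lxor_zero_eq.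
  split_bits x; split_bits y; split_bits z.
  rewrite balanced_double_bit, lxor_double_bit.
  pose proof (lxor_carry a a0) as [d Hd].
  unfold sum_triple.
  intros [H|[H|[[[[e He] (w & Hw & H)]|[[e He] H]]|[[[e He] (w & Hw & H)]|[[e He] H]]]]];
    destruct i, i0, i1; cbn [Nat.b2n xorb negb] in *; lia.
Qed.

Lemma P_balanced x y z : P (x, y, z) <-> balanced (x, y, z).
Proof.
  split.
  - intros H.
    assert (C : balanced (x, y, z) \/ balanced (x, z, y) \/ balanced (y, z, x)).
    { pose proof (P_sorted_balanced x y z); pose proof (P_sorted_balanced x z y);
        pose proof (P_sorted_balanced y z x).
      unfold P, P0, P1, some_order in H; tauto. }
    destruct C as [C|[C|C]]; auto using balanced_swap12, balanced_swap23.
  - intros H.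
    pose proof (balanced_sorted_P x y z); pose proof (balanced_sorted_P x z y);
      pose proof (balanced_sorted_P y z x).
    assert (balanced (x, z, y)) by auto using balanced_swap23.
    assert (balanced (y, z, x)) by auto using balanced_swap12, balanced_swap23.
    assert ((x <= z /\ y <= z) \/ (x <= y /\ z <= y) \/ (y <= x /\ z <= x)) by lia.
    unfold P, P0, P1, some_order; tauto.
Qed.

(** * Moves out of balanced positions *)

Lemma move_swap12 x y z u v w :
  move (x, y, z) (u, v, w) -> move (y, x, z) (v, u, w).
Proof.
  intros H; inversion H; subst; try (constructor; assumption).
  - rewrite Nat.add_comm; constructor; assumption.
  - rewrite Nat.add_comm; constructor; assumption.
Qed.

Lemma move_swap23 x y z u v w :
  move (x, y, z) (u, v, w) -> move (x, z, y) (u, w, v).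
Proof.
  intros H; inversion H; subst; try (constructor; assumption).
  - rewrite Nat.add_comm; constructor; assumption.
  - rewrite Nat.add_comm; constructor; assumption.
Qed.

Lemma balanced_remove x y z w :
  balanced (x, y, z) -> balanced (x, y, w) -> w = z.
Proof.
  split_bits x; split_bits y; split_bits z; split_bits w.
  rewrite !balanced_double_bit; intros [<- H] [<- H'].
  destruct i, i0, i1, i2; cbn [xorb negb] in *; intuition congruence.
Qed.

Lemma balanced_amalgamate x y z :
  2 <= x -> 2 <= y -> balanced (x, y, z) -> ~ balanced (x + y, 0, z).
Proof.
  intros Hx Hy H H0.
  (* An empty pile rules out a sum triple, so the other two piles agree in half and low bit. *)
  assert (x + y = z) as <-.
  { remember (x + y) as s.
    clear - H0; split_bits s; split_bits z.
    change 0 with (2 * 0 + Nat.b2n false) in H0.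
    rewrite balanced_double_bit in H0.
    rewrite Nat.lxor_0_r in H0; unfold sum_triple in H0.
    destruct H0 as [<- H0]; destruct i, i0; cbn [xorb negb] in *; lia. }
  clear H0.
  remember (x + y) as z.
  split_bits x; split_bits y; split_bits z.
  rewrite balanced_double_bit in H; destruct H as [E H].
  pose proof (lxor_carry a a0) as [d Hd]; rewrite E in Hd.
  unfold sum_triple in H.
  (* Now [4 * d + i + i0 = i1], which forces [d = 0]. *)
  destruct i, i0, i1; cbn [Nat.b2n xorb negb] in *; lia.
Qed.

Lemma balanced_move p q : move p q -> balanced p -> ~ balanced q.
Proof.
  intros M B B'; destruct M as
    [x y z u L|x y z v L|x y z w L|x y z L L'|x y z L L'|x y z L L'
    |x y z L L'|x y z L L'|x y z L L'].
  - assert (u = x); [|lia].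
    apply (balanced_remove y z); auto using balanced_swap12, balanced_swap23.
  - assert (v = y); [|lia].
    apply (balanced_remove x z); auto using balanced_swap23.
  - assert (w = z); [|lia].
    now apply (balanced_remove x y).
  - now apply (balanced_amalgamate x y z).
  - apply (balanced_amalgamate x y z); auto using balanced_swap12.
  - apply (balanced_amalgamate y z x);
      auto using balanced_swap12, balanced_swap23.
  - apply (balanced_amalgamate y z x);
      auto using balanced_swap12, balanced_swap23.
  - apply (balanced_amalgamate x z y);
      auto using balanced_swap12, balanced_swap23.
  - apply (balanced_amalgamate x z y);
      auto using balanced_swap12, balanced_swap23.
Qed.

(** * Replies to unbalanced positions *)

Definition has_reply (p : position) : Prop := exists q, move p q /\ balanced q.

Lemma has_reply_swap12 x y z : has_reply (x, y, z) -> has_reply (y, x, z).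
Proof.
  intros ([[u v] w] & M & B); exists (v, u, w).
  auto using move_swap12, balanced_swap12.
Qed.

Lemma has_reply_swap23 x y z : has_reply (x, y, z) -> has_reply (x, z, y).
Proof.
  intros ([[u v] w] & M & B); exists (u, w, v).
  auto using move_swap23, balanced_swap23.
Qed.

Lemma nim_reply x y z :
  Nat.lxor (Nat.div2 x) (Nat.div2 y) < Nat.div2 z -> has_reply (x, y, z).
Proof.
  split_bits x; split_bits y; split_bits z.
  rewrite !div2_double_bit; intros L.
  assert (exists k,
    xorb (xorb i i0) k = true <-> sum_triple a a0 (Nat.lxor a a0)) as [k Hk].
  { destruct (excluded_middle_informative
      (sum_triple a a0 (Nat.lxor a a0))) as [S|S].
    - exists (negb (xorb i i0)); destruct i, i0; cbn; tauto.
    - exists (xorb i i0); destruct i, i0; cbn; intuition discriminate. }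
  exists (2 * a + Nat.b2n i, 2 * a0 + Nat.b2n i0,
          2 * Nat.lxor a a0 + Nat.b2n k); split.
  (* The half drops strictly, so the pile shrinks whatever its new low bit. *)
  - constructor; destruct k, i1; cbn [Nat.b2n]; lia.
  - now rewrite balanced_double_bit.
Qed.

(** Only the parity of the low bits is wrong, and clearing one bit repairs it without touching the
    halves. *)
Lemma odd_reply x y z :
  Nat.lxor (Nat.div2 x) (Nat.div2 y) = Nat.div2 z -> ~ balanced (x, y, z) ->
  Nat.odd z = true -> has_reply (x, y, z).
Proof.
  split_bits x; split_bits y; split_bits z.
  rewrite !div2_double_bit, odd_double_bit, balanced_double_bit; intros E B ->.
  exists (2 * a + Nat.b2n i, 2 * a0 + Nat.b2n i0, 2 * a1 + Nat.b2n false); split.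
  - constructor; cbn [Nat.b2n]; lia.
  - rewrite balanced_double_bit; split; [exact E|].
    unfold sum_triple in *; destruct i, i0; cbn [xorb negb] in *; lia.
Qed.

(** The reply leaves two equal piles beside an empty one. *)
Lemma amalgamation_reply x y z :
  2 <= x -> 2 <= y -> x + y = z -> has_reply (x, y, z).
Proof.
  intros Hx Hy <-; exists (x + y, 0, x + y); split; [now constructor|].
  split; [apply Nat.lxor_0_r|].
  rewrite xorb_false_r, xorb_nilpotent; unfold sum_triple; cbn [Nat.div2]; lia.
Qed.

Lemma unbalanced_has_reply x y z : ~ balanced (x, y, z) -> has_reply (x, y, z).
Proof.
  intros B.
  destruct (Nat.eq_dec (Nat.lxor (Nat.div2 x) (Nat.div2 y)) (Nat.div2 z)) as [E|E].
  - destruct (Nat.odd z) eqn:Oz; [now apply odd_reply|].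
    destruct (Nat.odd y) eqn:Oy.
    { apply has_reply_swap23, odd_reply; auto using lxor_eq_swap, balanced_swap23. }
    destruct (Nat.odd x) eqn:Ox.
    { apply has_reply_swap12, has_reply_swap23, odd_reply;
        auto using balanced_swap12, balanced_swap23.
      apply lxor_eq_swap; now rewrite Nat.lxor_comm. }
    (* With all low bits 0, imbalance can only come from a sum triple. *)
    assert (S : sum_triple (Nat.div2 x) (Nat.div2 y) (Nat.div2 z)).
    { unfold balanced in B; rewrite Ox, Oy, Oz in B; cbn [xorb] in B.
      unfold sum_triple in *; lia. }
    pose proof (Nat.div2_odd x) as Dx; pose proof (Nat.div2_odd y) as Dy;
      pose proof (Nat.div2_odd z) as Dz.
    rewrite Ox in Dx; rewrite Oy in Dy; rewrite Oz in Dz; cbn [Nat.b2n] in *.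
    destruct S as (? & ? & ? & [S|[S|S]]).
    + apply amalgamation_reply; lia.
    + apply has_reply_swap23, amalgamation_reply; lia.
    + apply has_reply_swap12, has_reply_swap23, has_reply_swap12, amalgamation_reply; lia.
  - destruct (nim_reduce _ _ _ E) as [L|[L|L]].
    + now apply nim_reply.
    + now apply has_reply_swap23, nim_reply.
    + now apply has_reply_swap12, has_reply_swap23, nim_reply.
Qed.

(* The second summand counts the nonempty piles: an amalgamation keeps the number
   of stones but empties a pile. *)
Definition size (p : position) : nat :=
  let '(x, y, z) := p in
  (x + y + z) + (Nat.min 1 x + Nat.min 1 y + Nat.min 1 z).

Lemma move_size p q : move p q -> size q < size p.
Proof. intros []; unfold size; lia. Qed.

(** * Winning strategies *)

Lemma balanced_wins s p :
  (forall q, ~ balanced q -> move q (s q) /\ balanced (s q)) ->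
  balanced p -> previous_wins s p.
Proof.
  intros Hs; induction p as [p IH] using (induction_ltof1 _ size); intros B.
  constructor; intros q M.
  destruct (Hs q (balanced_move p q M B)) as [M' B'].
  split; [exact M'|]; apply IH; [|exact B'].
  apply move_size in M, M'; unfold ltof; lia.
Qed.

(** If [p] were unbalanced, the opponent could move to a balanced [q]; the answer [s q] would be
    unbalanced yet still winning for [s], against induction. *)
Lemma previous_wins_balanced s p : previous_wins s p -> balanced p.
Proof.
  induction p as [[[x y] z] IH] using (induction_ltof1 _ size); intros [H].
  destruct (excluded_middle_informative (balanced (x, y, z))) as [B|B]; [exact B|].
  apply unbalanced_has_reply in B; destruct B as (q & M & B).
  destruct (H q M) as [M' W].
  destruct (balanced_move _ _ M' B); apply IH; [|exact W].
  apply move_size in M, M'; unfold ltof; lia.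
Qed.

Theorem theorem2 (x y z : nat) : P_position (x, y, z) <-> P (x, y, z).
Proof.
  rewrite P_balanced; split.
  - intros [s W]; exact (previous_wins_balanced s _ W).
  - intros B.
    (* Choice selects a balanced reply wherever one exists; elsewhere the value is arbitrary. *)
    exists (fun q => epsilon (inhabits q) (fun r => move q r /\ balanced r)).
    apply balanced_wins; [|exact B].
    intros [[u v] w] N; apply epsilon_spec, unbalanced_has_reply, N.
Qed.
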